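(* Let $d\ge 2$ and let $y_1,\ldots,y_n\in\mathbb{R}^d$ be in type $B$ general position. Then the number of cones in the Weyl tessellation $\mathcal{W}^B(y_1,\ldots,y_n)$ of type $B_n$ equals $$D^B(n,d):=2\big(B[n,n-d+1]+B[n,n-d+3]+B[n,n-d+5]+\cdots\big).$$
   Context: Type $B$ general position: vectors $y_1,\ldots,y_n\in\mathbb{R}^d$ are said to be in type $B$ general position if $n\ge d$ and, for every $\varepsilon=(\varepsilon_1,\ldots,\varepsilon_n)\in\{\pm1\}^n$ and every permutation $\sigma$ of $\{1,\ldots,n\}$, any $d$ of the vectors $\varepsilon_1y_{\sigma(1)}-\varepsilon_2y_{\sigma(2)},\,\varepsilon_2y_{\sigma(2)}-\varepsilon_3y_{\sigma(3)},\ldots,\varepsilon_{n-1}y_{\sigma(n-1)}-\varepsilon_ny_{\sigma(n)},\,\varepsilon_ny_{\sigma(n)}$ are linearly independent. For $x\in\mathbb{R}^d\setminus\{0\}$ let $x^\perp=\{v\in\mathbb{R}^d:\langle v,x\rangle=0\}$. The Weyl tessellation $\mathcal{W}^B(y_1,\ldots,y_n)$ of type $B_n$ is the set of cones obtained as closures of the connected components of the complement in $\mathbb{R}^d$ of the union of the hyperplanes $(y_i+y_j)^\perp$ and $(y_i-y_j)^\perp$ for $1\le i<j\le n$, and $y_i^\perp$ for $1\le i\le n$. The numbers $B[n,k]$ are defined by $(t+1)(t+3)\cdots(t+2n-1)=\sum_{k=0}^nB[n,k]\,t^k$, and $B[n,k]=0$ for $k\notin\{0,\ldots,n\}$. *)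

(* Defs.v *)
From mathcomp Require Import all_boot all_order all_algebra all_fingroup.
From mathcomp Require Import all_classical all_reals all_analysis.
Set Implicit Arguments.
Unset Strict Implicit.
Unset Printing Implicit Defensive.
Import Order.TTheory GRing.Theory Num.Theory.
Import numFieldNormedType.Exports.
Local Open Scope classical_set_scope.
Local Open Scope ring_scope.

(* The sign vector is encoded by booleans: the i-th sign is (-1) ^+ eps i. *)
Definition signed_vec (R : realType) (n d : nat) (y : 'I_n -> 'rV[R]_d)
    (eps : 'I_n -> bool) (s : {perm 'I_n}) (i : 'I_n) : 'rV[R]_d :=
  (-1) ^+ eps i *: y (s i).

(* insub i.+1 is None exactly when i is the last index, i.+1 = n. *)
Definition typeB_vec (R : realType) (n d : nat) (y : 'I_n -> 'rV[R]_d)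
    (eps : 'I_n -> bool) (s : {perm 'I_n}) (i : 'I_n) : 'rV[R]_d :=
  if insub i.+1 is Some j then signed_vec y eps s i - signed_vec y eps s j
  else signed_vec y eps s i.

Definition typeB_general_position (R : realType) (n d : nat)
    (y : 'I_n -> 'rV[R]_d) : Prop :=
  (d <= n)%N /\
  forall (eps : 'I_n -> bool) (s : {perm 'I_n}) (I : {set 'I_n}),
    #|I| = d -> free [seq typeB_vec y eps s i | i <- enum I].

Definition dotv (R : realType) (d : nat) (u v : 'rV[R]_d) : R :=
  \sum_(k < d) u 0 k * v 0 k.

Definition orthv (R : realType) (d : nat) (x : 'rV[R]_d) : set 'rV[R]_d :=
  [set v | dotv v x = 0].

Definition typeB_arrangement (R : realType) (n d : nat)
    (y : 'I_n -> 'rV[R]_d) : set 'rV[R]_d :=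
  (\bigcup_(p in [set p : 'I_n * 'I_n | (p.1 < p.2)%N])
      (orthv (y p.1 + y p.2) `|` orthv (y p.1 - y p.2)))
  `|` \bigcup_i orthv (y i).

Definition connected_components (T : topologicalType) (A : set T) :
    set (set T) :=
  [set connected_component A x | x in A].

Definition weyl_tessellationB (R : realType) (n d : nat)
    (y : 'I_n -> 'rV[R]_d) : set (set 'rV[R]_d) :=
  [set closure C | C in connected_components (~` typeB_arrangement y)].

Definition Bpoly (n : nat) : {poly nat} :=
  \prod_(1 <= i < n.+1) ('X + (2 * i - 1)%N%:P).

(* The index is an integer, so that n - d + 1 below is not truncated. *)
Definition Bnum (n : nat) (k : int) : nat :=
  if k is Posz m then ((Bpoly n)`_m)%R else 0%N.

(* n - d + 1 + 2 i > n for i >= d, so all further terms of the series are 0. *)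
Definition DB (n d : nat) : nat :=
  (2 * \sum_(0 <= i < d) Bnum n (n%:Z - d%:Z + 1 + (2 * i)%N%:Z))%N.

(* Main.v *)
Require Import Defs.
From mathcomp Require Import all_boot all_order all_algebra all_fingroup.
From mathcomp Require Import all_classical all_reals all_analysis.
From mathcomp Require Import ring lra zify.
Set Implicit Arguments.
Unset Strict Implicit.
Unset Printing Implicit Defensive.
Import Order.TTheory GRing.Theory Num.Theory.
Import numFieldNormedType.Exports.
Local Open Scope classical_set_scope.
Local Open Scope card_scope.
Local Open Scope ring_scope.

(** The cones of the tessellation correspond to the sign patterns that a point
    off the arrangement can give to the linear forms [v |-> dotv v w], for [w]
    among the [y i], [y i + y j], [y i - y j] with [i < j]
    ([connected_component_cone], [closure_cone_inj]). So the task is to count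
    realizable sign patterns.

    More generally, for a subspace [W] and a list [L] of vectors, let
    [nregions W L] be the number of strict sign patterns that [L] takes on the
    orthogonal complement of [W]. Deletion and restriction ([nregions_cons])
    says that adding a vector [w] outside [W] to [L] increases this number by
    [nregions (W + <[w]>) L], the number of old regions that the new hyperplane
    meets.

    Apply this to the [2n + 1] vectors that [y] adds to the type B arrangement of
    [n] vectors [ys], namely [y] and [y + z], [y - z] for [z] in [ys]. Restricting
    to the hyperplane of any one of them identifies [y] with 0 or with some
    [+- z], so the other hyperplanes through [y] become hyperplanes of the
    arrangement of [ys] ([typeB_seq_restriction]), and what remains is the type B
    arrangement of [n] vectors in one dimension less. General position passes to
    it: a chain of differences of [ys] extends to one of [y :: ys] by inserting
    [y] next to [z], or at the end, which adds exactly the vector divided out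
    ([general_position_restriction_gen]). Hence the number [D(n, d)] of cones
    satisfies
      [D(n + 1, d + 1) = D(n, d + 1) + (2n + 1) D(n, d)],
    and so does the expression [DB], because the polynomial defining the numbers
    [Bnum (n + 1)] is the one for [n] times [X + (2n + 1)] ([DBS]). *)

(** * Scalar product and sign conditions *)

Lemma dotvDl (R : realType) d (u v w : 'rV[R]_d) :
  dotv (u + v) w = dotv u w + dotv v w.
Proof.
by rewrite /dotv -big_split /=; apply: eq_bigr => k _; rewrite mxE mulrDl.
Qed.

Lemma dotvZl (R : realType) d a (u w : 'rV[R]_d) :
  dotv (a *: u) w = a * dotv u w.
Proof.
by rewrite /dotv mulr_sumr; apply: eq_bigr => k _; rewrite mxE mulrA.
Qed.

Lemma dotvC (R : realType) d (u v : 'rV[R]_d) : dotv u v = dotv v u.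
Proof. by apply: eq_bigr => k _; rewrite mulrC. Qed.

Lemma dotvDr (R : realType) d (u v w : 'rV[R]_d) :
  dotv u (v + w) = dotv u v + dotv u w.
Proof. by rewrite !(dotvC u) dotvDl. Qed.

Lemma dotvZr (R : realType) d a (u w : 'rV[R]_d) :
  dotv u (a *: w) = a * dotv u w.
Proof. by rewrite !(dotvC u) dotvZl. Qed.

Lemma dotv0l (R : realType) d (w : 'rV[R]_d) : dotv 0 w = 0.
Proof. by rewrite -(scale0r (0 : 'rV_d)) dotvZl mul0r. Qed.

Definition orthogonal_to (R : realType) d (W : {vspace 'rV[R]_d})
    (v : 'rV[R]_d) : Prop :=
  forall w, w \in W -> dotv v w = 0.

Lemma orthogonal_toD1 (R : realType) d (W : {vspace 'rV[R]_d}) v w :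
  orthogonal_to (W + <[w]>)%VS v <-> orthogonal_to W v /\ dotv v w = 0.
Proof.
split=> [vWw|[vW vw] _ /memv_addP[a aW [_ /vlineP[k ->] ->]]].
  split=> [u uW|]; apply: vWw; last by rewrite memvE addvSr.
  by rewrite (subvP (addvSl _ _)).
by rewrite dotvDr dotvZr vW // vw mulr0 addr0.
Qed.

(** Nondegeneracy of the scalar product: [w] is separated from [W] by a vector
    of the orthogonal complement. A column of the cokernel of a basis matrix of
    [W] does it. *)
Lemma exists_orthogonal (R : realType) d (W : {vspace 'rV[R]_d}) w :
  w \notin W -> exists2 u, orthogonal_to W u & dotv u w != 0.
Proof.
move=> wW; set M : 'M[R]_(\dim W, d) := \matrix_(i < \dim W) (vbasis W)`_i.
have dotE (x : 'rV[R]_d) j :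
    dotv (col j (cokermx M))^T x = (x *m cokermx M) 0 j.
  by rewrite mxE; apply: eq_bigr => k _; rewrite !mxE mulrC.
have : ~~ (w <= M)%MS.
  apply: contra wW => /submxP[D ->]; rewrite mulmx_sum_row.
  apply: memv_suml => i _; rewrite memvZ // rowK.
  by apply/vbasis_mem/mem_nth; rewrite size_tuple.
rewrite submxE => /rV0Pn[j nz]; exists (col j (cokermx M))^T; last by rewrite dotE.
move=> x /coord_vbasis ->; rewrite dotE mulmx_suml.
rewrite big1 ?mxE // => i _; rewrite -scalemxAl.
have -> : (vbasis W)`_i *m cokermx M = row i M *m cokermx M by rewrite rowK.
by rewrite -row_mul mulmx_coker row0 scaler0.
Qed.

Definition realizes (R : realType) d (v : 'rV[R]_d) (L : seq 'rV[R]_d)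
    (s : bitseq) : bool :=
  all2 (fun w (b : bool) => 0 < (-1) ^+ b * dotv v w) L s.

Lemma realizes_cone (R : realType) d (v1 v2 : 'rV[R]_d) L s a b :
  0 <= a -> 0 <= b -> 0 < a + b -> realizes v1 L s -> realizes v2 L s ->
  realizes (a *: v1 + b *: v2) L s.
Proof.
move=> a0 b0 ab0.
have pos x y : 0 < x -> 0 < y -> 0 < a * x + b * y.
  move=> x0 y0; have [ap|ap] := ltP 0 a;
    first by rewrite ltr_pwDl ?mulr_gt0 ?mulr_ge0 // ltW.
  by rewrite ltr_wpDl ?mulr_ge0 ?mulr_gt0 // ?ltW //; lra.
elim: L s => [|w L IH] [|c s] //= /andP[h1 r1] /andP[h2 r2].
rewrite [X in _ && X]IH // andbT dotvDl !dotvZl.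
by rewrite mulrDr (mulrCA _ a) (mulrCA _ b) pos.
Qed.

(** Strict sign conditions are open: they survive a small move in any fixed
    direction [u]. *)
Lemma realizes_perturb (R : realType) d (v u : 'rV[R]_d) L s :
  realizes v L s ->
  exists2 e : R, 0 < e & forall t, `|t| < e -> realizes (v + t *: u) L s.
Proof.
elim: L s => [|w L IH] [|c s] //=; first by exists 1.
move=> /andP[h1 /IH[e e0 he]].
set x := _ * dotv v w in h1; set y := (-1) ^+ c * dotv u w.
have y1 : 0 < `|y| + 1 by rewrite ltr_wpDl.
exists (Num.min e (x / (`|y| + 1))).
  by rewrite lt_min e0 divr_gt0.
move=> t; rewrite lt_min => /andP[/he -> ht]; rewrite andbT.
rewrite dotvDl dotvZl mulrDr mulrCA -/x -/y.
move: ht; rewrite ltr_pdivlMr // => ht.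
have := ler_norm (- (t * y)); rewrite normrN normrM => hn.
have : `|t| * `|y| <= `|t| * (`|y| + 1) by rewrite ler_wpM2l // lerDl.
lra.
Qed.

(** * Counting sign patterns *)

Fixpoint bitseqs n : seq bitseq :=
  if n is n'.+1 then map (cons true) (bitseqs n') ++ map (cons false) (bitseqs n')
  else [:: [::]].

Lemma mem_bitseqs n s : (s \in bitseqs n) = (size s == n).
Proof.
elim: n s => [|n IH] [|b s] //=; rewrite mem_cat.
  by apply/negbTE; rewrite negb_or; apply/andP; split; apply/mapP => -[].
rewrite eqSS -IH; case: b.
  rewrite mem_map; last by move=> ? ? [].
  by rewrite orbC; case: mapP => // -[? ?].
rewrite [X in _ || X]mem_map; last by move=> ? ? [].
by case: mapP => // -[? ?].
Qed.

Lemma bitseqs_uniq n : uniq (bitseqs n).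
Proof.
elim: n => //= n IH; rewrite cat_uniq !map_inj_uniq ?IH; try by move=> ? ? [].
rewrite andbT /=; apply/hasPn => _ /mapP[s _ ->]; by apply/mapP => -[].
Qed.

Definition realizable (R : realType) d (W : {vspace 'rV[R]_d}) L s : Prop :=
  exists2 v, orthogonal_to W v & realizes v L s.

(** When every vector of [L] acts on the orthogonal complement of [W] as a
    nonzero linear form, this is the number of regions that the hyperplanes
    orthogonal to [L] cut out there; if some form vanishes, it is 0. *)
Definition nregions (R : realType) d (W : {vspace 'rV[R]_d}) L : nat :=
  count (fun s => `[< realizable W L s >]) (bitseqs (size L)).

Lemma nregions_nil (R : realType) d (W : {vspace 'rV[R]_d}) :
  nregions W [::] = 1%N.
Proof.
rewrite /nregions /= addn0; case: asboolP => // -[]; exists 0 => //.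
by move=> w _; rewrite dotv0l.
Qed.

Lemma nregions_eq0 (R : realType) d (W : {vspace 'rV[R]_d}) L w :
  w \in L -> w \in W -> nregions W L = 0%N.
Proof.
move=> wL wW; rewrite /nregions; apply/eqP; rewrite -leqn0 leqNgt -has_count.
apply/hasPn => s _; apply/asboolP => -[v /(_ _ wW) vw].
elim: L s wL => [|x L IH] [|b s] //=; rewrite inE => /orP[/eqP <-|/IH h].
  by rewrite vw mulr0 ltxx.
by case/andP=> _ /h.
Qed.

(** Deletion and restriction. A new hyperplane [w] cuts an old region in two
    exactly when it meets it: on a segment joining the two sides some point lies
    on [w], and conversely a point of [w] inside an open region can be moved to
    either side. Hence each old region counts once, and once more if it leaves a
    trace on [w]. *)
Lemma nregions_cons (R : realType) d (W : {vspace 'rV[R]_d}) w L :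
  w \notin W -> nregions W (w :: L) = (nregions W L + nregions (W + <[w]>) L)%N.
Proof.
move=> wW; have [u uW uw] := exists_orthogonal wW.
have move_off v s (b : bool) : orthogonal_to W v -> realizes v L s ->
    dotv v w = 0 -> realizable W (w :: L) (b :: s).
  move=> vW vL vw; have [e e0 he] := realizes_perturb u vL.
  pose c : R := (-1) ^+ b * Num.sg (dotv u w) * (e / 2).
  exists (v + c *: u).
    by move=> x xW; rewrite dotvDl dotvZl vW // uW // mulr0 addr0.
  rewrite /= he ?andbT.
    rewrite dotvDl dotvZl vw add0r /c.
    set a := dotv u w; set S := (-1) ^+ b.
    have -> : S * (S * Num.sg a * (e / 2) * a) = S ^+ 2 * (Num.sg a * a) * (e / 2).
      by ring.
    by rewrite sqrr_sign mul1r -normrEsg mulr_gt0 ?normr_gt0 ?divr_gt0.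
  rewrite /c 2!normrM normrX normrN1 expr1n mul1r normr_sg uw mul1r.
  by rewrite gtr0_norm; lra.
rewrite /nregions /= count_cat !count_map.
rewrite -count_predUI; congr (_ + _)%N; apply: eq_count => s /=.
  apply/orP/asboolP => [[]/asboolP[v vW /= /andP[_ vL]]|[v vW vL]];
    try by exists v.
  have [vw|vw|vw] := ltgtP (dotv v w) 0.
  - left; apply/asboolP; exists v => //=.
    by rewrite vL expr1 mulN1r oppr_gt0 vw.
  - right; apply/asboolP; exists v => //=.
    by rewrite vL expr0 mul1r vw.
  - by left; apply/asboolP; apply: move_off vW vL vw.
apply/andP/asboolP => [[/asboolP[v1 W1 /= /andP[]] ]|[v vWw vL]].
  rewrite expr1 mulN1r oppr_gt0 => n1 L1.
  move=> /asboolP[v2 W2 /= /andP[]]; rewrite expr0 mul1r => p2 L2.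
  exists (dotv v2 w *: v1 + (- dotv v1 w) *: v2).
    apply/orthogonal_toD1; split.
      by move=> x xW; rewrite dotvDl !dotvZl (W1 x xW) (W2 x xW) !mulr0 addr0.
    by rewrite dotvDl !dotvZl; ring.
  by apply: realizes_cone => //; lra.
have /orthogonal_toD1[vW vw] := vWw.
by split; apply/asboolP; apply: move_off vW vL vw.
Qed.

(** Hyperplanes that coincide, on the complement of [W], with hyperplanes of [L]
    create no new region. *)
Lemma nregions_absorb (R : realType) d (W : {vspace 'rV[R]_d}) Q L :
  (forall q, q \in Q -> exists2 q', q' \in L & q' \in (W + <[q]>)%VS) ->
  nregions W (Q ++ L) = nregions W L.
Proof.
elim: Q => //= q Q IH hQ; have [q' q'L q'W] := hQ q (mem_head _ _).
have {}IH : nregions W (Q ++ L) = nregions W L.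
  by apply: IH => x xQ; apply: hQ; rewrite inE xQ orbT.
have [qW|qW] := boolP (q \in W).
  rewrite (nregions_eq0 (mem_head _ _) qW) (nregions_eq0 q'L) //.
  by move: q'W; rewrite (addv_idPl _).
rewrite nregions_cons // IH [X in (_ + X)%N](@nregions_eq0 _ _ _ _ q') ?addn0 //.
by rewrite mem_cat q'L orbT.
Qed.

(** * The arrangement and its general position, relative to a subspace *)

Fixpoint typeB_seq (V : zmodType) (ys : seq V) : seq V :=
  if ys is y :: ys' then
    flatten [seq [:: y + z; y - z] | z <- ys'] ++ y :: typeB_seq ys'
  else [::].

(** Consecutive differences, with [t] appended to [s] as a last point; the chains
    of type B general position have [t = 0]. *)
Fixpoint differences (V : zmodType) (s : seq V) (t : V) : seq V :=
  if s is z :: s' then (z - head t s') :: differences s' t else [::].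

(** A boolean codes the sign, [true] being the minus sign. *)
Definition signed (R : pzRingType) (V : lmodType R) (p : bool * V) : V :=
  (-1) ^+ p.1 *: p.2.

(** General position of [ys] in the quotient of the space by [W], tested on at
    most [d] vectors at a time. Allowing fewer than [d] vectors [ys] and working
    modulo [W] is what makes the property stable under deletion and
    restriction. *)
Definition general_position_mod (K : fieldType) (V : vectType K)
    (W : {vspace V}) (ys : seq V) (d : nat) : Prop :=
  forall (ps : seq (bool * V)) (m : bitseq),
    perm_eq (unzip2 ps) ys -> size m = size ps -> (count id m <= d)%N ->
    \dim (<<mask m (differences (map (@signed K V) ps) 0%R)>> + W)
      = (count id m + \dim W)%N.

Lemma size_differences (V : zmodType) (s : seq V) t :
  size (differences s t) = size s.
Proof. by elim: s => //= z s ->. Qed.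

Lemma differences_cat (V : zmodType) (s1 s2 : seq V) t :
  differences (s1 ++ s2) t = differences s1 (head t s2) ++ differences s2 t.
Proof. by elim: s1 => //= z s1 ->; case: s1. Qed.

Lemma addvCA (K : fieldType) (V : vectType K) (A B C : {vspace V}) :
  (A + (B + C) = B + (A + C))%VS.
Proof. by rewrite !addvA (addvC A). Qed.

(** The final reference point [t] of a chain of differences only matters modulo
    the subspace one works in. *)
Lemma span_differences_mod (K : fieldType) (V : vectType K) (U : {vspace V})
    s m (t t' : V) :
  t - t' \in U ->
  (<<mask m (differences s t)>> + U)%VS = (<<mask m (differences s t')>> + U)%VS.
Proof.
move=> tU; elim: s m => [|z s IH] [|b m] //=.
have hU : (z - head t s) - (z - head t' s) \in U.
  case: s {IH} => [|x s] /=; last by rewrite subrr mem0v.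
  by rewrite opprB addrC addrA subrK -memvN opprB.
case: b; last exact: IH.
rewrite !span_cons -!addvA IH !(addvCA _ <<_>>%VS); congr (_ + _)%VS.
move: hU; set a := z - _; set b := z - _ => hU.
have sub (x y : V) : x - y \in U -> (<[x]> + U <= <[y]> + U)%VS.
  move=> xyU; rewrite subv_add addvSr andbT -memvE.
  by rewrite -(subrK y x) addrC memv_add ?memv_line.
by apply/eqP; rewrite eqEsubv !sub // -memvN opprB.
Qed.

Lemma mem_unzip2 (S T : eqType) (ps : seq (S * T)) z :
  z \in unzip2 ps -> exists e, (e, z) \in ps.
Proof. by case/mapP => -[e z'] eps /= ->; exists e. Qed.

Lemma mask_nseq_true (T : Type) (a b : nat) (s1 s2 : seq T) x :
  size s1 = a -> mask (nseq a false ++ true :: nseq b false) (s1 ++ x :: s2) = [:: x].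
Proof. by move=> <-; rewrite mask_cat ?size_nseq //= !mask_false. Qed.

(** A chain for [ys] is the tail of a chain that starts with [y]. *)
Lemma general_position_deletion (K : fieldType) (V : vectType K)
    (W : {vspace V}) y ys d :
  general_position_mod W (y :: ys) d -> general_position_mod W ys d.
Proof.
move=> gp ps m ps_ys sz_m m_d.
have := gp ((false, y) :: ps) (false :: m).
by rewrite /= perm_cons sz_m; apply.
Qed.

(** Restriction to the hyperplane orthogonal to [w]. If [w] is, up to a scalar,
    the difference created when [y] is inserted with a suitable sign somewhere
    into any chain [ps], then modulo [w] the longer chain is the old one, with [w]
    itself as the extra vector; so independence of [d.+1] vectors modulo [W]
    gives independence of [d] vectors modulo [W + <[w]>]. *)
Lemma general_position_restriction_gen (K : fieldType) (V : vectType K)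
    (W : {vspace V}) y w ys d :
  general_position_mod W (y :: ys) d.+1 ->
  (forall ps, perm_eq (unzip2 ps) ys -> exists e p1 p2, ps = p1 ++ p2 /\
     <[signed (e, y) - head 0%R (map (@signed K V) p2)]>%VS = <[w]>%VS) ->
  w \notin W /\ general_position_mod (W + <[w]>) ys d.
Proof.
move=> gp ins.
have insE (e : bool) p1 p2 : perm_eq (unzip2 (p1 ++ p2)) ys ->
    perm_eq (unzip2 (p1 ++ (e, y) :: p2)) (y :: ys).
  rewrite /unzip2 !map_cat /= => h.
  by rewrite -cat1s perm_catCA /= perm_cons.
have dimW : \dim (W + <[w]>) = (\dim W).+1.
  have ps_ys : perm_eq (unzip2 [seq (false, z) | z <- ys]) ys.
    by rewrite /unzip2 -map_comp map_id.
  have [e [p1 [p2 [E wE]]]] := ins _ ps_ys; rewrite E in ps_ys.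
  have := gp _ (nseq (size p1) false ++ true :: nseq (size p2) false) (insE e p1 p2 ps_ys).
  rewrite map_cat differences_cat /= mask_nseq_true; last first.
    by rewrite size_differences size_map.
  rewrite span_seq1 wE count_cat /= !count_nseq /= addvC; apply => //.
  by rewrite !size_cat /= !size_nseq.
split.
  apply/negP => wW; have /addv_idPl WE : (<[w]> <= W)%VS by rewrite -memvE.
  by move: dimW; rewrite WE => /eqP; rewrite -[X in X == _]addn0 -addn1 eqn_add2l.
move=> ps m ps_ys sz_m m_d.
have [e [p1 [p2 [E wE]]]] := ins _ ps_ys; rewrite {}E in ps_ys sz_m *.
set m1 := take (size p1) m; set m2 := drop (size p1) m.
have sz1 : size m1 = size p1.
  by rewrite size_takel // sz_m size_cat leq_addr.
have mE : m = m1 ++ m2 by rewrite cat_take_drop.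
have cE : count id (m1 ++ true :: m2) = (count id m).+1.
  by rewrite mE !count_cat /= addnS.
have := gp _ (m1 ++ true :: m2) (insE e p1 p2 ps_ys).
rewrite cE dimW addSnnS => <-; last first.
- by [].
- by move: sz_m; rewrite mE !size_cat /= => sz; rewrite !addnS sz.
rewrite !map_cat !differences_cat mE !mask_cat ?size_differences ?size_map //=.
set u := signed (e, y) in wE *; set z := head 0 _ in wE *.
rewrite !span_cat !span_cons wE -!addvA [(W + _)%VS]addvC.
have -> : (<[w]> + (<<mask m2 (differences (map (@signed K V) p2) 0%R)>> + W) =
  <<mask m2 (differences (map (@signed K V) p2) 0%R)>> + (<[w]> + W))%VS.
  by rewrite addvCA.
rewrite !(addvCA _ <<mask m2 _>>%VS); congr (\dim (_ + _)).
by apply: span_differences_mod; rewrite -wE -memvN opprB memvE addvSl.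
Qed.

Lemma signed_line (K : fieldType) (V : vectType K) (c : K) (x : V) :
  c != 0 -> <[c *: x]>%VS = <[x]>%VS.
Proof.
move=> c0; apply/eqP; rewrite eqEsubv -!memvE memvZ ?memv_line //=.
by rewrite -{1}(scalerK c0 x) memvZ ?memv_line.
Qed.

Lemma general_position_restrict_vector (K : fieldType) (V : vectType K)
    (W : {vspace V}) y ys d :
  general_position_mod W (y :: ys) d.+1 ->
  y \notin W /\ general_position_mod (W + <[y]>) ys d.
Proof.
move=> gp; apply: general_position_restriction_gen gp _ => ps _.
exists false, ps, [::]; rewrite cats0; split => //=.
by rewrite /signed expr0 scale1r subr0.
Qed.

Lemma general_position_restrict_pair (K : fieldType) (V : vectType K)
    (W : {vspace V}) y ys d z (b : bool) :
  general_position_mod W (y :: ys) d.+1 -> z \in ys ->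
  y + (-1) ^+ b *: z \notin W /\
  general_position_mod (W + <[y + (-1) ^+ b *: z]>) ys d.
Proof.
move=> gp zys; apply: general_position_restriction_gen gp _ => ps ps_ys.
move: zys; rewrite -(perm_mem ps_ys) => /mem_unzip2[e /splitPr[p1 p2]].
(* Sign of y such that (sign of y) y - (sign of z) z is proportional to w. *)
exists (~~ (e (+) b)), p1, ((e, z) :: p2); split => //=.
rewrite /signed /=; have -> : (-1) ^+ (~~ (e (+) b)) *: y - (-1) ^+ e *: z
    = (-1) ^+ (~~ (e (+) b)) *: (y + (-1) ^+ b *: z).
  rewrite scalerDr scalerA -signr_addb; congr (_ + _).
  by rewrite -scaleNr; congr (_ *: _); case: e; case: b; rewrite ?expr0 ?expr1 ?opprK.
by rewrite signed_line ?signr_eq0.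
Qed.

(** A repeated vector would make [y - z] vanish. *)
Lemma general_position_uniq (K : fieldType) (V : vectType K)
    (W : {vspace V}) ys d :
  general_position_mod W ys d.+1 -> uniq ys.
Proof.
elim: ys => //= y ys IH gp.
rewrite (IH (general_position_deletion gp)) andbT; apply/negP => yys.
have [] := general_position_restrict_pair true gp yys.
by rewrite expr1 scaleN1r subrr mem0v.
Qed.

(** * Counting by deletion and restriction *)

Lemma typeB_seq_single (V : zmodType) (ys : seq V) y :
  y \in ys -> y \in typeB_seq ys.
Proof.
elim: ys => //= x ys IH; rewrite inE mem_cat inE => /orP[->|/IH ->];
by rewrite !orbT.
Qed.

Lemma typeB_seq_pair (R : pzRingType) (V : lmodType R) (ys : seq V) x y (b : bool) :
  x \in ys -> y \in ys -> x != y ->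
  exists c : bool, (-1) ^+ c *: (x + (-1) ^+ b *: y) \in typeB_seq ys.
Proof.
have pairP (u v : V) (s : seq V) (e : bool) : v \in s ->
    u + (-1) ^+ e *: v \in flatten [seq [:: u + z; u - z] | z <- s].
  move=> vs; apply/flatten_mapP; exists v => //; rewrite !inE.
  by case: e; rewrite ?expr1 ?expr0 ?scaleN1r ?scale1r eqxx ?orbT.
elim: ys => //= z ys IH; rewrite !inE.
case/predU1P=> [->|xys] /predU1P[->|yys] xy.
- by rewrite eqxx in xy.
- by exists false; rewrite expr0 scale1r mem_cat pairP.
- exists b; rewrite scalerDr scalerA -signr_addb addbb expr0 scale1r addrC.
  by rewrite mem_cat pairP.
- by have [c h] := IH xys yys xy; exists c; rewrite mem_cat inE h !orbT.
Qed.

(** Restriction identifies [y] with [z], up to sign: on the complement of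
    [y + e z], every vector involving [y] agrees up to a nonzero scalar with one
    that does not, [y] with [z], [y + f x] with [x - e f z], and [y - e z] with
    [z], the scalar then being 2 or -2. *)
Lemma typeB_seq_restriction (K : fieldType) (V : vectType K)
    (W : {vspace V}) ys y z (e : bool) q : (2 : K) != 0 -> z \in ys ->
  q = y \/ (exists2 x, x \in ys & exists2 f : bool, q = y + (-1) ^+ f *: x &
    (x == z) ==> (f != e)) ->
  exists2 q', q' \in typeB_seq ys & q' \in (W + <[y + (-1) ^+ e *: z]> + <[q]>)%VS.
Proof.
move=> two_neq0 zys hq; set w := y + _.
have inU (k : K) : k *: (w - q) \in (W + <[w]> + <[q]>)%VS.
  apply/memvZ/memvB; last by rewrite memvE addvSr.
  by rewrite memvE (subv_trans _ (addvSl _ _)) ?addvSr.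
case: hq => [qy|[x xys [f qE]]].
  exists z; first exact: typeB_seq_single.
  have := inU ((-1) ^+ e); rewrite qy /w addrAC subrr add0r scalerA -signr_addb.
  by rewrite addbb expr0 scale1r.
have wqE : w - q = (-1) ^+ e *: z - (-1) ^+ f *: x.
  by rewrite /w qE opprD addrACA subrr add0r.
case: eqVneq => [xz /= fe|xz _].
  exists z; first exact: typeB_seq_single.
  have := inU ((-1) ^+ e / 2); rewrite wqE xz.
  have -> : (-1) ^+ f = - (-1) ^+ e :> K.
    by case: e f fe {inU w wqE qE} => -[] // _; rewrite ?expr0 ?expr1 ?opprK.
  rewrite scaleNr opprK -mulr2n -scaler_nat !scalerA.
  by rewrite ?mulrA divrK ?unitfE // -signr_addb addbb expr0 scale1r.
have [|c hc] := @typeB_seq_pair _ _ ys z x (~~ (e (+) f)) zys xys.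
  by rewrite eq_sym.
exists ((-1) ^+ c *: (z + (-1) ^+ (~~ (e (+) f)) *: x)) => //.
suff -> : (-1) ^+ c *: (z + (-1) ^+ (~~ (e (+) f)) *: x)
    = (-1) ^+ (c (+) e) *: (w - q) by [].
rewrite wqE signr_addb -scalerA; congr (_ *: _).
rewrite scalerBr !scalerA -!signr_addb addbb expr0 scale1r -scaleNr.
by congr (_ + _ *: _); case: (e (+) f); rewrite ?expr0 ?expr1 ?opprK.
Qed.

(** This differs from [DB] at [n = 0], where the empty arrangement has one
    region in every dimension. *)
Fixpoint ncones (n d : nat) : nat :=
  match n, d with
  | 0, _ => 1
  | n'.+1, 0 => 0
  | n'.+1, d'.+1 => ncones n' d'.+1 + n'.*2.+1 * ncones n' d'
  end%N.

(** Adding the vectors that involve [y] one at a time, each step contributes the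
    count for [size ys] vectors in one dimension less; there are
    [2 * size ys + 1] steps. In dimension 0 every form vanishes and there is no
    region. *)
Lemma nregions_typeB (R : realType) (m : nat) (W : {vspace 'rV[R]_m}) ys d :
  general_position_mod W ys d -> (\dim W + d)%N = m ->
  nregions W (typeB_seq ys) = ncones (size ys) d.
Proof.
elim: ys W d => [|y ys IH] W d gp dimW; first exact: nregions_nil.
case: d => [|d] in gp dimW *.
  apply: (@nregions_eq0 _ _ _ _ y); first by rewrite typeB_seq_single ?mem_head.
  suff -> : W = fullv by rewrite memvf.
  apply/eqP; rewrite eqEdim subvf dimvf /dim /=; move: dimW; lia.
have ys_uniq : uniq ys by have := general_position_uniq gp; case/andP.
have restr w : w \notin W -> general_position_mod (W + <[w]>) ys d ->
    nregions (W + <[w]>) (typeB_seq ys) = ncones (size ys) d.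
  move=> wW gpw; apply: IH => //; apply: etrans dimW; rewrite addnS -addSn; congr (_ + _)%N.
  have w0 : w != 0 by apply: contraNneq wW => ->; rewrite mem0v.
  rewrite dimv_disjoint_sum ?dim_vline ?w0 ?addn1 //.
  apply/eqP; rewrite -subv0; apply/subvP => x /memv_capP[xW /vlineP[k xk]].
  rewrite xk in xW *; have [->|k0] := eqVneq k 0; first by rewrite scale0r mem0v.
  by case/negP: wW; rewrite -(scalerK k0 w) memvZ.
have [yW gpy] := general_position_restrict_vector gp.
have gp' := general_position_deletion gp.
(* The y + z and y - z are added one z at a time, so the induction is on a part
   zs of ys while the old arrangement stays that of all of ys. *)
suff H zs : {subset zs <= ys} -> uniq zs ->
    nregions W (flatten [seq [:: y + z; y - z] | z <- zs] ++ y :: typeB_seq ys)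
    = (ncones (size ys) d.+1 + (size zs).*2.+1 * ncones (size ys) d)%N.
  by rewrite /= H.
elim: zs => [|z zs IHzs] sub /=.
  by rewrite nregions_cons // restr // (IH W d.+1) // mul1n.
move=> /andP[zzs zs_uniq].
have zys : z \in ys by apply: sub; rewrite mem_head.
have {}sub : {subset zs <= ys} by move=> x xs; apply: sub; rewrite inE xs orbT.
have old q : q \in flatten [seq [:: y + z0; y - z0] | z0 <- zs] ++ [:: y] ->
    q = y \/ (exists2 x, x \in zs & exists f : bool, q = y + (-1) ^+ f *: x).
  rewrite mem_cat => /orP[/flatten_mapP[x xs]|]; last by rewrite inE => /eqP; left.
  rewrite !inE => h; right; exists x => //.
  case/orP: h => /eqP ->; first by exists false; rewrite expr0 scale1r.
  by exists true; rewrite expr1 scaleN1r.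
have [] := general_position_restrict_pair false gp zys.
have [] := general_position_restrict_pair true gp zys.
have two_neq0 : (2 : R) != 0 by rewrite pnatr_eq0.
have := fun q => @typeB_seq_restriction _ _ W ys y z true q two_neq0 zys.
have := fun q => @typeB_seq_restriction _ _ W ys y z false q two_neq0 zys.
rewrite expr0 expr1 scale1r scaleN1r => absP absM wM gpM wP gpP.
rewrite nregions_cons // nregions_cons //.
rewrite IHzs // -cat1s catA.
rewrite -[X in nregions _ (X :: _)]/(y - z) -cat_cons.
rewrite !(@nregions_absorb _ _ (W + _)) ?restr //;
  first by rewrite /= doubleS !mulSn; lia.
- move=> q; rewrite inE => /predU1P[->|/old[->|[x xs [f ->]]]].
  + by apply: absP => //; right; exists z => //; exists true;
       rewrite ?expr1 ?scaleN1r ?eqxx.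
  + by apply: absP => //; left.
  + apply: absP => //; right; exists x; first exact: sub.
    by exists f => //; apply/implyP => /eqP xz; rewrite -xz xs in zzs.
- move=> q /old[->|[x xs [f ->]]].
  + by apply: absM => //; left.
  + apply: absM => //; right; exists x; first exact: sub.
    by exists f => //; apply/implyP => /eqP xz; rewrite -xz xs in zzs.
Qed.

(** * Cones as components of the complement *)

Lemma continuous_dotv (R : realType) d (w : 'rV[R]_d) :
  continuous (fun v => dotv v w).
Proof.
have -> : (fun v => dotv v w) = \sum_(k < d) (fun v : 'rV[R]_d => v 0 k * w 0 k).
  by apply/funext => v; rewrite fct_sumE.
elim/big_ind: _ => [|f g cf cg|k _] v; first exact: (@cst_continuous _ _ (0 : R)).
  exact: (cvgD (cf v) (cg v)).
exact: (cvgMr_tmp (@coord_continuous R 1 d 0 k v)).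
Qed.

Lemma segment_connected_rV (R : realType) d (x y : 'rV[R]_d) :
  connected [set (1 - t) *: x + t *: y | t in `[0, 1]].
Proof.
apply: connected_continuous_connected; first exact: segment_connected.
apply: continuous_subspaceT => t; apply: cvgD; apply: cvgZr_tmp => //.
by apply: cvgB => //; exact: cvg_cst.
Qed.

Definition cone (R : realType) d (L : seq 'rV[R]_d) (s : bitseq) :
  set 'rV[R]_d := [set v | realizes v L s].

Definition signs (R : realType) d (L : seq 'rV[R]_d) (v : 'rV[R]_d) : bitseq :=
  [seq dotv v w < 0 | w <- L].

Lemma realizesE (R : realType) d (v : 'rV[R]_d) L s :
  realizes v L s = all (fun w => dotv v w != 0) L && (s == signs L v).
Proof.
elim: L s => [|w L IH] [|b s] //=; first by rewrite andbF.
rewrite [X in _ && X]IH eqseq_cons.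
suff -> : (0 < (-1) ^+ b * dotv v w) = (dotv v w != 0) && (b == (dotv v w < 0)).
  by rewrite -!andbA; congr andb; rewrite !andbA; congr andb; rewrite andbC.
case: b; rewrite ?expr1 ?expr0 ?mulN1r ?mul1r ?oppr_gt0;
by case: ltgtP.
Qed.

Lemma mem_closure_cone (R : realType) d (L : seq 'rV[R]_d) s v :
  closure (cone L s) v -> all2 (fun w (b : bool) => 0 <= (-1) ^+ b * dotv v w) L s.
Proof.
elim: L s => [|w L IH] [|b s] cl /=; try by have [? []] := cl _ filterT.
rewrite IH ?andbT; last by apply: closureS cl => u /= /andP[].
pose H := [set u : 'rV[R]_d | 0 <= (-1) ^+ b * dotv u w].
suff : closed H.
  apply; apply: closureS cl => u /= /andP[h _]; exact: ltW.
apply: (@closed_comp _ _ (fun u : 'rV[R]_d => (-1) ^+ b * dotv u w)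
  [set x | 0 <= x]); last exact: closed_ge.
by move=> u _; exact: (cvgMl_tmp (@continuous_dotv _ _ w u)).
Qed.

(** The closure still determines the cone: a point of the open cone has nonzero
    values, whose signs the weak inequalities of another closed cone fix. *)
Lemma closure_cone_inj (R : realType) d (L : seq 'rV[R]_d) s s' v :
  cone L s v -> closure (cone L s) = closure (cone L s') -> s = s'.
Proof.
move=> vs E; have : closure (cone L s') v by rewrite -E; exact: subset_closure.
move=> /mem_closure_cone; elim: L s s' vs {E} => [|w L IH] [|b s] [|b' s'] //=.
move=> /andP[h /IH{}IH] /andP[h' /IH ->]; congr (_ :: _).
case: b b' h h' => -[] //; rewrite ?expr1 ?expr0 ?mulN1r ?mul1r;
by rewrite ?oppr_gt0 ?oppr_ge0 => /lt_geF ->.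
Qed.

(** The components of the complement are the cones: a cone is convex, hence
    connected; and a linear form without zero on a connected set keeps its sign
    there. *)
Lemma connected_component_cone (R : realType) d (L : seq 'rV[R]_d) s x :
  cone L s x ->
  connected_component [set v | all (fun w => dotv v w != 0) L] x = cone L s.
Proof.
move=> xs; apply/seteqP; split => [y [C [Cx CL cC] Cy]|y ys].
  suff h w b : w \in L -> 0 < (-1) ^+ b * dotv x w -> 0 < (-1) ^+ b * dotv y w.
    move: xs; rewrite /cone /= /realizes.
    elim: L s {CL} h => [|w L IH] [|b s] //= h /andP[/h-> /=]; last exact: mem_head.
    by apply: IH => w' b' w'L; apply: h; rewrite inE w'L orbT.
  move=> wL xw; rewrite ltNge; apply/negP => yw.
  pose f v := (-1) ^+ b * dotv v w.
  have : connected (f @` C).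
    apply: connected_continuous_connected => //; apply: continuous_subspaceT => v.
    exact: (cvgMl_tmp (@continuous_dotv _ _ w v)).
  move=> /connected_intervalP/(_ (f y) (f x) (imageP f Cy) (imageP f Cx) 0).
  rewrite yw ltW // => /(_ isT)[v Cv /eqP].
  rewrite mulf_eq0 signr_eq0 /=; apply/negP.
  by have /allP/(_ w wL) := CL _ Cv.
have seg : [set (1 - t) *: x + t *: y | t in `[0, 1]] `<=` cone L s.
  move=> _ [t + <-]; rewrite /= in_itv /= => /andP[t0 t1].
  by apply: realizes_cone; rewrite ?subr_ge0 // subrK ltr01.
apply: (connected_component_max _ _ (@segment_connected_rV _ _ x y)).
- by exists 0; rewrite /= ?in_itv /= ?lexx ?ler01 // subr0 scale1r scale0r addr0.
- by move=> v /seg; rewrite /cone /= realizesE => /andP[].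
- by exists 1; rewrite /= ?in_itv /= ?lexx ?ler01 // subrr scale0r scale1r add0r.
Qed.

Lemma card_tessellation (R : realType) d (L : seq 'rV[R]_d) :
  [set closure C | C in
    connected_components [set v | all (fun w => dotv v w != 0) L]]
  #= `I_(nregions 0 L).
Proof.
set S := [seq s <- bitseqs (size L) | `[< realizable 0%VS L s >]].
have sizeS : size S = nregions 0 L by rewrite size_filter.
have uniqS : uniq S by rewrite filter_uniq ?bitseqs_uniq.
have SP s : s \in S -> exists v, cone L s v.
  by rewrite mem_filter => /andP[/asboolP[v _ vs] _]; exists v.
pose f i := closure (cone L (nth [::] S i)).
suff -> : [set closure C | C in
    connected_components [set v | all (fun w => dotv v w != 0) L]]
    = f @` `I_(nregions 0 L).
  apply: inj_card_eq => i j; rewrite !inE /= -!sizeS => iS jS fij.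
  have [v vi] := SP _ (mem_nth [::] iS).
  by apply/eqP; rewrite -(nth_uniq [::] iS jS uniqS) (closure_cone_inj vi fij).
apply/seteqP; split => [_ [_ [v vL <-] <-]|_ [i /= iS <-]].
  have vs : cone L (signs L v) v by rewrite /cone /= realizesE eqxx andbT.
  have sS : signs L v \in S.
    rewrite mem_filter mem_bitseqs size_map eqxx andbT.
    apply/asboolP; exists v => // w; rewrite memv0 => /eqP ->.
    by rewrite dotvC dotv0l.
  exists (index (signs L v) S); first by rewrite /= -sizeS index_mem.
  by rewrite /f nth_index // (connected_component_cone vs).
rewrite -sizeS in iS; have [v vs] := SP _ (mem_nth [::] iS).
exists (cone L (nth [::] S i)) => //; exists v; last exact: connected_component_cone.
by move: vs; rewrite /cone /= realizesE => /andP[].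
Qed.

(** * The numbers of type B *)

Lemma Bnum0 k : Bnum 0 k = (k == 0).
Proof. by case: k => // -[|k]; rewrite /Bnum /Bpoly big_geq // coef1. Qed.

Lemma BnumS n k : Bnum n.+1 k = (Bnum n (k - 1) + n.*2.+1 * Bnum n k)%N.
Proof.
have cE : (2 * n.+1 - 1)%N = n.*2.+1 by rewrite mulnS -mul2n; lia.
have Bn : Bpoly n.+1 = Bpoly n * ('X + (n.*2.+1)%:P).
  by rewrite /Bpoly big_nat_recr //= cE.
case: k => [[|k]|k].
- by rewrite /= Bn mulrDr coefD coefMX coefMC /= mulrC.
- have -> : Posz k.+1 - 1 = Posz k by lia.
  by rewrite /= Bn mulrDr coefD coefMX coefMC /= mulrC.
- have -> : Negz k - 1 = Negz k.+1 by lia.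
  by rewrite /= muln0.
Qed.

Lemma Bnum_gt n (k : int) : n%:Z < k -> Bnum n k = 0%N.
Proof.
elim: n k => [|n IH] k nk; first by rewrite Bnum0; case: eqVneq nk => // ->.
by rewrite BnumS !IH ?muln0 //; lia.
Qed.

(** In the recurrence of [Bnum], the term that lowers the index along with [n]
    gives a sum for the same dimension, while the term that keeps the index gives
    one for the dimension below, since [n - d] is then unchanged. *)
Lemma DBS n d : DB n.+1 d.+1 = (DB n d.+1 + n.*2.+1 * DB n d)%N.
Proof.
rewrite /DB mulnCA -mulnDr; congr (2 * _)%N.
rewrite (eq_bigr (fun i => Bnum n (n%:Z - d.+1%:Z + 1 + (2 * i)%N%:Z)
   + n.*2.+1 * Bnum n (n%:Z - d%:Z + 1 + (2 * i)%N%:Z))%N); last first.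
  by move=> i _; rewrite BnumS; congr (Bnum _ _ + _ * Bnum _ _)%N; lia.
rewrite big_split /=; congr (_ + _)%N.
rewrite -big_distrr /= big_nat_recr //= [X in (_ + X)%N]Bnum_gt ?addn0 //.
lia.
Qed.

(** Here [Bnum 0 k] is nonzero only for [k = 0], which the indices [1 - d + 2i]
    meet exactly for odd [d]. *)
Lemma DB0 d : DB 0 d = (2 * odd d)%N.
Proof.
suff [] : DB 0 d = (2 * odd d)%N /\ DB 0 d.+1 = (2 * odd d.+1)%N by [].
elim: d => [|d [IH0 IH1]].
  by rewrite /DB big_geq // big_nat1 Bnum0.
split => //; rewrite /= negbK -IH0 /DB; congr (2 * _)%N.
rewrite big_nat_recl // Bnum0.
rewrite [X in (X + _)%N](_ : _ = 0%N); last by case: eqP => //; lia.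
rewrite add0n big_nat_recr //= Bnum0.
rewrite [X in (_ + X)%N](_ : _ = 0%N); last by case: eqP => //; lia.
rewrite addn0; apply: eq_bigr => i _; rewrite !Bnum0; congr (nat_of_bool (_ == _)).
lia.
Qed.

Lemma ncones_DB n d : ncones n.+1 d = DB n.+1 d.
Proof.
elim: n d => [|n IH] [|d]; try by rewrite /DB big_geq.
  by rewrite DBS !DB0 /=; case: d => [|d]; case: (odd _).
by rewrite DBS -!IH.
Qed.

(** * The arrangement of the vectors [y] *)

Lemma nth_differences (V : zmodType) (s : seq V) t x i : (i < size s)%N ->
  nth x (differences s t) i = nth x s i - nth t s i.+1.
Proof. by elim: s i => [|z [|z' s] IH] [|i] //= /IH. Qed.

Lemma differences_ord (V : zmodType) n (f : 'I_n -> V) :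
  differences [seq f i | i <- enum 'I_n] 0 =
  [seq (if insub i.+1 is Some j then f i - f j else f i) | i : 'I_n <- enum 'I_n].
Proof.
have sz : size [seq f i | i <- enum 'I_n] = n by rewrite size_map size_enum_ord.
apply: (@eq_from_nth _ 0); first by rewrite size_differences !size_map.
move=> i; rewrite size_differences sz => i_n.
rewrite nth_differences ?sz // (nth_map (Ordinal i_n)) ?size_enum_ord //.
rewrite [RHS](nth_map (Ordinal i_n)) ?size_enum_ord //.
have -> : nth (Ordinal i_n) (enum 'I_n) i = Ordinal i_n.
  by apply: val_inj; rewrite /= nth_enum_ord.
case: insubP => /= [j _ ji|]; last first.
  by rewrite -leqNgt => n_i; rewrite [X in _ - X]nth_default ?sz // subr0.
rewrite (nth_map j) ?size_enum_ord -?ji ?ltn_ord //.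
by congr (_ - f _); apply: val_inj; rewrite /= nth_enum_ord.
Qed.

Lemma exists_superset_card (T : finType) (I : {set T}) d :
  (#|I| <= d <= #|T|)%N ->
  exists s : seq T, uniq (enum I ++ s) /\ size (enum I ++ s) = d.
Proof.
move=> /andP[I_d d_T]; exists (take (d - #|I|) (enum (~: I))); split.
  rewrite cat_uniq enum_uniq take_uniq ?enum_uniq // andbT /=.
  by apply/hasPn => x /mem_take; rewrite !mem_enum inE.
rewrite size_cat -cardE size_takel ?subnKC // -cardE.
by have := cardsC I; lia.
Qed.

(** Over the zero subspace, independence of any [d] vectors of a chain gives that
    of any smaller selection, which extends to [d] vectors as [d <= n]. *)
Lemma general_position_modP (R : realType) n d (y : 'I_n -> 'rV[R]_d) :
  typeB_general_position y ->
  general_position_mod 0 [seq y i | i <- enum 'I_n] d.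
Proof.
move=> [d_n gp] ps m ps_y sz_m m_d.
have [s sE] : exists s : {perm 'I_n}, unzip2 ps = [seq y (s i) | i <- enum 'I_n].
  have /tuple_permP[s sE] : perm_eq (unzip2 ps) [tuple y i | i < n] by [].
  by exists s; rewrite sE /=; apply: eq_map => i; rewrite tnth_mktuple.
have sz_ps : size ps = n by rewrite -(size_map snd) [map _ _]sE size_map size_enum_ord.
pose eps (i : 'I_n) := nth false (unzip1 ps) i.
have psE : [seq signed p | p <- ps] = [seq signed_vec y eps s i | i <- enum 'I_n].
  apply: (@eq_from_nth _ 0); first by rewrite size_map sz_ps size_map size_enum_ord.
  move=> i; rewrite size_map sz_ps => i_n.
  rewrite (nth_map (false, 0 : 'rV[R]_d)) ?sz_ps //.
  rewrite (nth_map (Ordinal i_n)) ?size_enum_ord //.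
  rewrite /signed_vec /signed /eps -(nth_map _ 0 snd) ?sz_ps //.
  rewrite [map snd _]sE (nth_map (Ordinal i_n)) ?size_enum_ord //.
  by rewrite nth_enum_ord // (nth_map (false, 0)) ?sz_ps.
rewrite psE differences_ord.
set I := [set i : 'I_n | nth false m i]%SET.
have mE : m = [seq i \in I | i <- enum 'I_n].
  apply: (@eq_from_nth _ false); first by rewrite size_map size_enum_ord sz_m.
  move=> i; rewrite sz_m sz_ps => i_n.
  by rewrite (nth_map (Ordinal i_n)) ?size_enum_ord // /I finset.in_set nth_enum_ord.
have maskE : mask m (enum 'I_n) = enum I.
  by rewrite {1}mE -filter_mask {2}/enum_mem -enumT; apply: eq_filter.
have cI : count id m = #|I|.
  by rewrite cardE -maskE size_mask // size_enum_ord sz_m.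
rewrite -map_mask maskE addv0 dimv0 addn0 cI.
have [|S [uS szS]] := @exists_superset_card _ I d.
  by rewrite -cI m_d card_ord.
have JS : perm_eq (enum [set i in enum I ++ S]%SET) (enum I ++ S).
  by apply: uniq_perm; rewrite ?enum_uniq // => x; rewrite mem_enum inE.
have : free [seq typeB_vec y eps s i | i <- enum I].
  have := gp eps s [set i in enum I ++ S]%SET.
  rewrite cardE (perm_size JS) szS (perm_free (perm_map _ JS)) map_cat.
  by move=> /(_ erefl) /catl_free.
by rewrite /free size_map -cardE => /eqP.
Qed.

Lemma all_typeB_seq (R : realType) d (v : 'rV[R]_d) ys :
  all (fun w => dotv v w != 0) (typeB_seq ys) =
  pairwise (fun a b => (dotv v (a + b) != 0) && (dotv v (a - b) != 0)) ys
  && all (fun w => dotv v w != 0) ys.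
Proof.
elim: ys => //= y ys IH; rewrite all_cat /= IH -!andbA.
have -> : all (fun w => dotv v w != 0) (flatten [seq [:: y + z; y - z] | z <- ys])
  = all (fun b => (dotv v (y + b) != 0) && (dotv v (y - b) != 0)) ys.
  by elim: ys {IH} => //= z ys ->; rewrite andbA.
by congr andb; rewrite andbCA.
Qed.

Lemma typeB_arrangementE (R : realType) n d (y : 'I_n -> 'rV[R]_d) :
  ~` typeB_arrangement y =
  [set v | all (fun w => dotv v w != 0) (typeB_seq [seq y i | i <- enum 'I_n])].
Proof.
apply/seteqP; split => v /=; rewrite all_typeB_seq.
  move=> nA; apply/andP; split; last first.
    apply/allP => _ /mapP[i _ ->]; apply/eqP => vi; apply: nA; right.
    by exists i.
  apply/(pairwiseP 0) => i j; rewrite !inE size_map size_enum_ord => i_n j_n ij.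
  rewrite !(nth_map (Ordinal i_n) 0 y) ?size_enum_ord //.
  set a := nth _ _ i; set b := nth _ _ j.
  have ab : (a < b)%N by rewrite /a /b !nth_enum_ord.
  by apply/andP; split; apply/eqP => v0; apply: nA; left; exists (a, b) => //; [left|right].
move=> /andP[/(pairwiseP 0) pw /allP nz] [[[a b] /= ab]|[i _ vi]]; last first.
  by have /eqP := nz (y i) (map_f _ (mem_enum 'I_n i)).
have {pw} := pw a b; rewrite !inE size_map size_enum_ord !ltn_ord => /(_ isT isT ab).
rewrite !(nth_map a 0 y) ?size_enum_ord ?ltn_ord // !nth_ord_enum => /andP[/eqP np /eqP nm].
by case.
Qed.

Theorem theorem1p3 (R : realType) (n d : nat) (hd : (2 <= d)%N)
    (y : 'I_n -> 'rV[R]_d) (hy : typeB_general_position y) :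
  weyl_tessellationB y #= `I_(DB n d).
Proof.
have sz : size [seq y i | i <- enum 'I_n] = n by rewrite size_map size_enum_ord.
have <- : nregions 0 (typeB_seq [seq y i | i <- enum 'I_n]) = DB n d.
  rewrite (nregions_typeB (general_position_modP hy)) ?dimv0 // sz.
  case: n y hy {sz} => [|n] y [dn _]; last exact: ncones_DB.
  by have := leq_trans hd dn.
by rewrite /weyl_tessellationB typeB_arrangementE; exact: card_tessellation.
Qed.
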